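(* Let $\Sigma$ be a complete rational simplicial fan. Two tropical toric reflexive sheaves $\mathcal E=(M,\{F^\rho_\bullet\}_\rho)$ and $\mathcal F=(N,\{G^\rho_\bullet\}_\rho)$ on $\mathrm{trop}(X_\Sigma)$ are isomorphic in the sense of Khan–Maclagan if and only if there is an isomorphism $f:\mathcal E\to\mathcal F$ in the category $\mathbf{TRS}_\bullet^\Sigma$.
   Context: **$\mathbb T$-matroids.** The tropical hyperfield is the idyll $\mathbb T=\mathbb R\sqcup\{\infty\}$ with multiplication given by addition of reals, zero element $\infty$, $-a=a$, and null set $N_{\mathbb T}$ consisting of the finite formal sums of real numbers which are empty or whose minimum is attained at least twice (terms equal to $\infty$ are discarded). For a tuple $\mathbf x$, $|\mathbf x|$ is its set of entries and $\mathbf x_{\hat k}$ is $\mathbf x$ with the $k$th entry deleted. A Grassmann–Plücker function of rank $r$ on a finite set $E$ is a map $\mu:E^r\to\mathbb T$, not identically $\infty$, symmetric, equal to $\infty$ on tuples with a repeated entry, with $\sum_{k=0}^r\mu(\mathbf x_{\hat k})\cdot\mu(x_k,\mathbf y)\in N_{\mathbb T}$ for all $\mathbf x\in E^{r+1}$, $\mathbf y\in E^{r-1}$. A $\mathbb T$-matroid (valuated matroid) of rank $r$ is a class $M=[\mu]$ up to multiplication by $\mathbb R=\mathbb T^\times$; the underlying matroid $\underline M$ has as bases the $\{e_1,\dots,e_r\}$ with $\mu(e_1,\dots,e_r)\neq\infty$. A pointed $\mathbb T$-matroid has ground set $E_M=\tilde E_M\sqcup\{*_M\}$ with $*_M$ a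 loop of $\underline M$; it is simple if $\underline M$ with $*_M$ deleted has no loops or parallel elements. Vectors: the dual of $[\mu]$ on $E$, $\#E=n$, is $[\mu^*]$ with $\mu^*(\mathbf x)=\mu(\mathbf x')$ for $|\mathbf x'|=E\setminus|\mathbf x|$ if $\mathbf x\in E^{n-r}$ has distinct entries, and $\infty$ otherwise. Circuits of $M$ are multiples by reals of the vectors $X_{\mathbf y}\in\mathbb T^E$, where $\mathbf y=(y_0,\dots,y_r)$ has distinct entries and some $\mu(\mathbf y_{\hat i})\ne\infty$, $X_{\mathbf y}(y_k)=\mu(\mathbf y_{\hat k})$, and $X_{\mathbf y}(x)=\infty$ otherwise. $\mathcal V_M$ is the set of $X$ with $\sum_eX_eY_e\in N_{\mathbb T}$ for all circuits $Y$ of $M^*$. For pointed $M$, $\mathcal V_M\subseteq\mathbb T^{\tilde E_M}$ is computed after deleting $*_M$. A morphism $f_{\mathbb T}:M\to N$ of pointed $\mathbb T$-matroids is a matrix over $\mathbb T$ with rows indexed by $\tilde E_N$, columns by $\tilde E_M$, at most one non-$\infty$ entry in each row and column, and $f_{\mathbb T}\cdot\mathcal V_M\subseteq\mathcal V_N$; composition is matrix multiplication. Its underlying map $\underline{f_{\mathbb T}}:E_M\to E_N$ (also written $f_{\mathbb T}$) sends $i$ to $j$ if the $(j,i)$ entry is not $\infty$, and everything else to $*_N$. **Sheaves.** $\Sigma$ is a complete rational simplicial fan in $L_{\mathbb R}$, $L$ free abelian of finite rank, $\Lambda=\mathrm{Hom}(L,\mathbb Z)$, $\Sigma(1)$ its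 set of rays, $v_\rho\in L$ the primitive vector of $\rho$. A (pointed) tropical toric reflexive sheaf on $\mathrm{trop}(X_\Sigma)$ is a tuple $\mathcal E=(M,\{F^\rho_\bullet\}_\rho)$ with $M$ a simple pointed $\mathbb T$-matroid and, for each $\rho\in\Sigma(1)$, flats $F^\rho_j$ of $\underline M$ ($j\in\mathbb Z$) with $F^\rho_j\supseteq F^\rho_{j+1}$, $F^\rho_j=\{*_M\}$ for $j\gg0$, $F^\rho_j=E_M$ for $j\ll0$. In $\mathbf{TRS}_\bullet^\Sigma$, a morphism $(M,\{F^\rho_\bullet\})\to(N,\{G^\rho_\bullet\})$ is a pair $(f_{\mathbb T},u)$ with $f_{\mathbb T}:M\to N$ a morphism of $\mathbb T$-matroids and $u\in\Lambda$ such that $f_{\mathbb T}(F^\rho_j)\subseteq G^\rho_{j+u\cdot v_\rho}$ for all $\rho\in\Sigma(1)$, $j\in\mathbb Z$; composition is $(g_{\mathbb T},w)\circ(f_{\mathbb T},u)=(g_{\mathbb T}f_{\mathbb T},u+w)$. **Khan–Maclagan isomorphism.** $\mathcal E$ and $\mathcal F$ are isomorphic in the sense of Khan–Maclagan if there are an isomorphism $f_{\mathbb T}:M\to N$ of $\mathbb T$-matroids and a vector $u\in\Lambda$ such that, under this isomorphism, $F^\rho_j=G^\rho_{j+u\cdot v_\rho}$, i.e. $f_{\mathbb T}(F^\rho_j)=G^\rho_{j+u\cdot v_\rho}$, for every $\rho\in\Sigma(1)$ and $j\in\mathbb Z$. *)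

(* Defs.v *)
From HB Require Import structures.
From mathcomp Require Import all_boot all_order all_algebra.
From mathcomp Require Import boolp classical_sets functions cardinality reals.

Set Implicit Arguments.
Unset Strict Implicit.
Unset Printing Implicit Defensive.

Import Order.TTheory GRing.Theory Num.Theory.
Local Open Scope ring_scope.

(* The tropical hyperfield is [option R], with [None] in the role of the zero
   element, infinity. *)

Section TropicalHyperfield.
Variable R : realType.
Implicit Types a b : option R.

Definition tmul a b : option R :=
  if a is Some x then if b is Some y then Some (x + y) else None else None.

Definition tmin a b : option R :=
  if a is Some x then if b is Some y then Some (Num.min x y) else a else b.

(* Membership in the null set; a formal sum is the sequence of its terms. *)
Definition tnull (s : seq (option R)) : bool :=
  let t := pmap id s in
  (t == [::]) ||
  has (fun m => all (fun x => m <= x) t && (2 <= count_mem m t)%N) t.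

End TropicalHyperfield.

Section GrassmannPlucker.
Variables (R : realType) (E : finType).

Definition del_entry r (x : r.+1.-tuple E) (k : 'I_r.+1) : r.-tuple E :=
  [tuple tnth x (lift k i) | i < r].

(* In the last clause [y] ranges over E^(r-1), which is empty when r = 0. *)
Definition is_gp r (mu : {ffun r.-tuple E -> option R}) : Prop :=
  [/\ exists x, mu x != None,
      forall x y : r.-tuple E, perm_eq x y -> mu x = mu y,
      forall x : r.-tuple E, ~~ uniq x -> mu x = None
    & forall (x : r.+1.-tuple E) (y : seq E) (hy : (size y).+1 == r),
        tnull [seq tmul (mu (del_entry x k))
                        (mu (@Tuple r E (tnth x k :: y) hy))
              | k <- enum 'I_r.+1]].

Definition tscale r (a : R) (mu : {ffun r.-tuple E -> option R}) :
    {ffun r.-tuple E -> option R} :=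
  [ffun x => tmul (Some a) (mu x)].

Record tmatroid := TMatroid {
  tm_rank : nat;
  tm_class : set {ffun tm_rank.-tuple E -> option R};
  tm_classP : exists2 mu, is_gp mu &
    forall nu, tm_class nu <-> exists a : R, nu = tscale a mu }.

(* By symmetry of [mu] the value does not depend on the [x'] picked; one exists
   whenever [x] has distinct entries and r <= #|E|. *)
Definition gp_dual r (mu : {ffun r.-tuple E -> option R}) :
    {ffun (#|E| - r).-tuple E -> option R} :=
  [ffun x : (#|E| - r).-tuple E =>
    if uniq x then
      if [pick x' : r.-tuple E | [set e in x']%SET == (~: [set e in x])%SET]
        is Some x' then mu x' else None
    else None].

Definition circuit_vec r (mu : {ffun r.-tuple E -> option R})
    (y : r.+1.-tuple E) : {ffun E -> option R} :=
  [ffun e => if [pick k | tnth y k == e] is Some k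
             then mu (del_entry y k) else None].

(* The notions below are stated for a set [C] of functions of rank r; it is
   meant to be the class of a T-matroid, possibly after dualizing or deleting
   a loop. *)

Definition dual_class r (C : set {ffun r.-tuple E -> option R}) :
    set {ffun (#|E| - r).-tuple E -> option R} :=
  fun nu => exists2 mu, C mu & nu = gp_dual mu.

Definition is_circuit r (C : set {ffun r.-tuple E -> option R})
    (X : {ffun E -> option R}) : Prop :=
  exists mu (y : r.+1.-tuple E) (a : R),
    [/\ C mu, uniq y, exists i, mu (del_entry y i) != None
      & X = [ffun e => tmul (Some a) (circuit_vec mu y e)]].

Definition is_vector r (C : set {ffun r.-tuple E -> option R})
    (X : {ffun E -> option R}) : Prop :=
  forall Y, is_circuit (dual_class C) Y ->
    tnull [seq tmul (X e) (Y e) | e <- enum E].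

(* The underlying matroid. *)

Definition bases r (C : set {ffun r.-tuple E -> option R}) : {set {set E}} :=
  [set B : {set E} | `[< exists mu (x : r.-tuple E),
     [/\ C mu, mu x != None & B = [set e in x]%SET] >]]%SET.

Definition indep r (C : set {ffun r.-tuple E -> option R}) (I : {set E}) :=
  [exists B in bases C, I \subset B].

Definition mrank r (C : set {ffun r.-tuple E -> option R}) (A : {set E}) : nat :=
  (\max_(I : {set E} | (I \subset A) && indep C I) #|I|)%N.

Definition is_flat r (C : set {ffun r.-tuple E -> option R}) (F : {set E}) :=
  [forall e, (e \notin F) ==> (mrank C F < mrank C (e |: F)%SET)%N].

Definition is_loop r (C : set {ffun r.-tuple E -> option R}) (e : E) :=
  ~~ indep C [set e]%SET.

Definition parallel r (C : set {ffun r.-tuple E -> option R}) (e e' : E) :=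
  [&& e != e', ~~ is_loop C e, ~~ is_loop C e' & ~~ indep C [set e; e']%SET].

End GrassmannPlucker.

Arguments tm_class {R E} t _.

(* A pointed ground set is [option A], with [None] the distinguished point. *)

Definition del_class (R : realType) (A : finType) r
    (C : set {ffun r.-tuple (option A) -> option R}) :
    set {ffun r.-tuple A -> option R} :=
  fun nu => exists2 mu, C mu & nu = [ffun x => mu (map_tuple Some x)].

Record ptmatroid (R : realType) := PTMatroid {
  pt_tilde : finType;
  pt_tm :> tmatroid R (option pt_tilde);
  pt_loop : is_loop (tm_class pt_tm) None }.

Section Pointed.
Variable R : realType.
Implicit Types M N : ptmatroid R.

Definition pt_vector M : {ffun pt_tilde M -> option R} -> Prop :=
  is_vector (del_class (tm_class M)).

Definition is_simple M : Prop :=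
  (forall e, ~~ is_loop (del_class (tm_class M)) e) /\
  (forall e e', ~~ parallel (del_class (tm_class M)) e e').

(* [tmatrix A B] holds matrices with rows indexed by B and columns by A.
   The addition in products is the minimum; in the products of matrices with at
   most one finite entry per row that occur here, each sum has at most one
   finite term. *)
Definition tmatrix (A B : finType) := {ffun B * A -> option R}.

Definition tmx_app (A B : finType) (f : tmatrix A B) (X : {ffun A -> option R}) :
    {ffun B -> option R} :=
  [ffun j => \big[@tmin R/None]_(i : A) tmul (f (j, i)) (X i)].

Definition tmx_comp (A B C : finType) (g : tmatrix B C) (f : tmatrix A B) :
    tmatrix A C :=
  [ffun p => \big[@tmin R/None]_(j : B) tmul (g (p.1, j)) (f (j, p.2))].

Definition tmx_id (A : finType) : tmatrix A A :=
  [ffun p => if p.1 == p.2 then Some 0 else None].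

Definition tm_morphism M N (f : tmatrix (pt_tilde M) (pt_tilde N)) : Prop :=
  [/\ forall j i i', f (j, i) != None -> f (j, i') != None -> i = i',
      forall i j j', f (j, i) != None -> f (j', i) != None -> j = j'
    & forall X, pt_vector X -> pt_vector (tmx_app f X)].

Definition tm_isomorphism M N (f : tmatrix (pt_tilde M) (pt_tilde N)) : Prop :=
  tm_morphism f /\
  exists g : tmatrix (pt_tilde N) (pt_tilde M),
    [/\ tm_morphism g, tmx_comp g f = tmx_id _ & tmx_comp f g = tmx_id _].

Definition underlying_map (A B : finType) (f : tmatrix A B) (x : option A) :
    option B :=
  if x is Some i then [pick j | f (j, i) != None] else None.

End Pointed.

Section Fans.
Variables (R : realType) (L : zmodType) (LR : vectType R).
Variable iota : {additive L -> LR}.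

(* [L] is free abelian of finite rank and [iota] exhibits [LR] as the tensor
   product of [L] with R: some Z-basis of [L] is sent to an R-basis of [LR]. *)
Definition is_realification : Prop :=
  exists b : seq L,
    (forall x : L, exists! c : {ffun 'I_(size b) -> int},
       x = \sum_(i < size b) b`_i *~ c i) /\
    basis_of fullv (map iota b).

Definition cone (vs : seq LR) : set LR :=
  fun x => exists c : 'I_(size vs) -> R,
    (forall i, 0 <= c i) /\ x = \sum_(i < size vs) c i *: vs`_i.

Definition rational_simplicial_cone (s : set LR) : Prop :=
  exists2 vs : seq L, free (map iota vs) & s = cone (map iota vs).

Definition face (t s : set LR) : Prop :=
  exists2 m : 'Hom(LR, R^o), forall x, s x -> 0 <= m x &
    t = (fun x => s x /\ m x = 0).

Definition complete_rational_simplicial_fan (Sigma : set (set LR)) : Prop :=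
  [/\ finite_set Sigma,
      forall s, Sigma s -> rational_simplicial_cone s,
      forall s t, Sigma s -> face t s -> Sigma t,
      forall s t, Sigma s -> Sigma t ->
        face (s `&` t)%classic s /\ face (s `&` t)%classic t
    & forall x : LR, exists2 s, Sigma s & s x].

Definition ray (Sigma : set (set LR)) : Type :=
  {rho : set LR | Sigma rho /\
     exists2 v : L, iota v != 0 & rho = cone [:: iota v]}.

(* This excludes v = 0, since 0 = w *+ 0. *)
Definition primitive (v : L) : Prop :=
  forall (w : L) (k : nat), v = w *+ k -> k = 1%N.

(* Under [is_realification] there is exactly one such [v]. *)
Definition ray_vec (Sigma : set (set LR)) (rho : ray Sigma) : L :=
  xget 0 (fun v : L => primitive v /\ sval rho = cone [:: iota v]).

Record trs (Sigma : set (set LR)) := Trs {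
  trs_M : ptmatroid R;
  trs_simple : is_simple trs_M;
  trs_flat : ray Sigma -> int -> {set option (pt_tilde trs_M)};
  trs_flatP : forall rho j, is_flat (tm_class trs_M) (trs_flat rho j);
  trs_decr : forall rho j, trs_flat rho (j + 1) \subset trs_flat rho j;
  trs_small : forall rho, exists j0 : int,
    forall j, j0 <= j -> trs_flat rho j = [set None]%SET;
  trs_large : forall rho, exists j0 : int,
    forall j, j <= j0 -> trs_flat rho j = [set: option (pt_tilde trs_M)]%SET }.

End Fans.

Section Category.
Variables (R : realType) (L : zmodType) (LR : vectType R).
Variables (iota : {additive L -> LR}) (Sigma : set (set LR)).
Implicit Types E F : trs iota Sigma.

(* The dual lattice Hom(L, Z) is [{additive L -> int}]. *)
Definition trs_pair E F : Type :=
  (tmatrix R (pt_tilde (trs_M E)) (pt_tilde (trs_M F)) *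
   {additive L -> int})%type.

Definition trs_morphism E F (f : trs_pair E F) : Prop :=
  tm_morphism f.1 /\
  forall (rho : ray iota Sigma) (j : int),
    underlying_map f.1 @: trs_flat E rho j
      \subset trs_flat F rho (j + f.2 (ray_vec rho)).

Definition trs_comp E F G (g : trs_pair F G) (f : trs_pair E F) :
    trs_pair E G :=
  (tmx_comp g.1 f.1, (f.2 \+ g.2 : {additive L -> int})).

Definition trs_id E : trs_pair E E := (tmx_id R _, (\0 : {additive L -> int})).

Definition trs_isomorphism E F (f : trs_pair E F) : Prop :=
  trs_morphism f /\
  exists g : trs_pair F E,
    [/\ trs_morphism g, trs_comp g f = trs_id E & trs_comp f g = trs_id F].

Definition km_isomorphic E F : Prop :=
  exists (f : tmatrix R (pt_tilde (trs_M E)) (pt_tilde (trs_M F)))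
         (u : {additive L -> int}),
    tm_isomorphism f /\
    forall (rho : ray iota Sigma) (j : int),
      underlying_map f @: trs_flat E rho j =
      trs_flat F rho (j + u (ray_vec rho)).

End Category.

(* Main.v *)
Require Import Defs.
From mathcomp Require Import all_boot all_order all_algebra.
From mathcomp Require Import boolp classical_sets reals.

(** Passing from a matrix to its underlying map is functorial enough to send
    mutually inverse morphisms of T-matroids to mutually inverse maps of ground
    sets ([underlying_mapK]): a diagonal entry of the product is a minimum of
    products, so it can be finite only if some index [j] links both factors, and
    the monomial shape of the matrices forces the underlying maps to go through
    that [j].

    Given this, both directions are about inverse bijections that shift indices.
    If f carries every F_j onto G_(j+u.v), then its inverse carries G_j into
    F_(j-u.v), so (f, u) and (f^-1, -u) are inverse morphisms of sheaves.
    Conversely, if (f, u) and (g, w) are inverse to each other, then w = -u, and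
    applying f to the inclusion of g(G_(j+u.v)) in F_j gives the inclusion of
    G_(j+u.v) in f(F_j), which is the one missing for equality. *)

Set Implicit Arguments.
Unset Strict Implicit.
Unset Printing Implicit Defensive.

Import GRing.Theory.
Local Open Scope ring_scope.

Lemma additive_ext (U V : nmodType) (u v : {additive U -> V}) :
  u =1 v -> u = v.
Proof.
case: u v => [u cu] [v cv] /= /funext uv; case: _ / uv cv => cv.
by congr GRing.Additive.Pack; case: cu cv => [[mu]] [[mv]];
  rewrite (Prop_irrelevance mu mv).
Qed.

Section UnderlyingMap.
Variable R : realType.

Lemma bigtmin_neq_None (I : finType) (F : I -> option R) :
  \big[@tmin R/None]_(i : I) F i != None -> exists i, F i != None.
Proof.
move=> Fn0; apply/existsP; apply: contraR Fn0 => /existsPn F0.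
apply/eqP; apply: (big_ind (eq^~ None)) => // [a b -> -> //|i _].
by apply/eqP; have := F0 i; rewrite negbK.
Qed.

Lemma tmul_neq_None (a b : option R) :
  tmul a b != None -> (a != None) && (b != None).
Proof. by case: a b => [a|] [b|]. Qed.

Lemma underlying_map_eq (A B : finType) (f : tmatrix R A B) (i : A) (j : B) :
  (forall i j j', f (j, i) != None -> f (j', i) != None -> j = j') ->
  f (j, i) != None -> underlying_map f (Some i) = Some j.
Proof.
move=> f_col fji /=; case: pickP => [j' fj'i|/(_ j)]; last by rewrite fji.
by rewrite (f_col _ _ _ fji fj'i).
Qed.

Lemma underlying_mapK (M N : ptmatroid R)
    (f : tmatrix R (pt_tilde M) (pt_tilde N))
    (g : tmatrix R (pt_tilde N) (pt_tilde M)) :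
  tm_morphism f -> tm_morphism g -> tmx_comp g f = tmx_id R _ ->
  cancel (underlying_map f) (underlying_map g).
Proof.
move=> [_ f_col _] [_ g_col _] gf [i|] //.
have : tmx_comp g f (i, i) != None by rewrite gf ffunE /= eqxx.
rewrite ffunE => /bigtmin_neq_None [j /tmul_neq_None /andP [gij fji]].
by rewrite (underlying_map_eq f_col fji) (underlying_map_eq g_col gij).
Qed.

End UnderlyingMap.

Theorem proposition6p3 (R : realType) (L : zmodType) (LR : vectType R)
    (iota : {additive L -> LR}) (hL : is_realification iota)
    (Sigma : set (set LR))
    (hSigma : complete_rational_simplicial_fan iota Sigma)
    (E F : trs iota Sigma) :
  km_isomorphic E F <-> exists f : trs_pair E F, trs_isomorphism f.
Proof.
split=> [[f [u [[f_mor [g [g_mor gf fg]]] fE]]] | [[f u] [[f_mor fE]]]].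
  exists (f, u); split; first by split=> // rho j; rewrite fE.
  exists (g, (\- u : {additive L -> int})); split.
  - split=> // rho j /=; rewrite -[j in trs_flat F _ j](subrK (u (ray_vec rho))).
    rewrite -fE -imset_comp (eq_imset _ (underlying_mapK f_mor g_mor gf)).
    by rewrite imset_id.
  - by congr pair => //; apply: additive_ext => x /=; rewrite subrr.
  - by congr pair => //; apply: additive_ext => x /=; rewrite addNr.
move=> [[g w] [[g_mor gE] [gf uw] [fg _]]].
exists f, u; split; first by split=> //; exists g.
move=> rho j; apply/eqP; rewrite finset.eqEsubset fE /=.
have uwv : u (ray_vec rho) + w (ray_vec rho) = 0.
  exact: (congr1 (@^~ (ray_vec rho)) uw).
apply/fintype.subsetP => y Gy; apply/imsetP; exists (underlying_map g y).
  have /fintype.subsetP := gE rho (j + u (ray_vec rho)); rewrite -addrA uwv addr0.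
  by apply; apply: imset_f.
by rewrite (underlying_mapK g_mor f_mor fg).
Qed.
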